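(* For every real $\sigma > 2$ there is no online algorithm for the $\sigma$-interval coloring problem with asymptotic competitive ratio less than $7/4$.
   Context: For a real $\sigma \ge 1$, the $\sigma$-interval coloring problem is: given a sequence of closed real intervals $[l_1,r_1],\ldots,[l_n,r_n]$ with $1 \le r_i-l_i \le \sigma$ for every $i$, find colors $c_1,\ldots,c_n$ such that for all $i\neq j$, $[l_i,r_i]\cap[l_j,r_j]\neq\emptyset$ implies $c_i\neq c_j$, minimizing the number of distinct colors used. In the online setting the intervals are presented one by one, in an arbitrary order (as intervals, i.e. with their endpoints), and a deterministic algorithm must assign a color to each interval immediately and irrevocably when it is presented, without knowledge of later intervals; $\sigma$ is a fixed parameter of the problem. A set (or sequence, with repetitions allowed) of intervals is $\chi$-colorable if its intersection graph can be properly colored (offline) with at most $\chi$ colors. For an online algorithm $A$, $A(\chi)$ denotes the maximum number of colors $A$ uses on any input that is $\chi$-colorable. $A$ has asymptotic competitive ratio $\alpha$ (is $\alpha$-competitive) if $\limsup_{\chi\to\infty} A(\chi)/\chi \le \alpha$. *)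

(* Defs.v *)
From mathcomp Require Import all_boot all_order all_algebra.
From mathcomp Require Import all_classical all_reals all_analysis.

Set Implicit Arguments.
Unset Strict Implicit.
Unset Printing Implicit Defensive.

Import Order.TTheory GRing.Theory Num.Theory.
Local Open Scope classical_set_scope.
Local Open Scope ring_scope.

Section OnlineIntervalColoring.
Variable R : realType.

(* The pair (l, r) stands for the closed interval [l, r]. *)
Implicit Types (I J : R * R) (s : seq (R * R)).

Definition overlap I J : Prop := (`[I.1, I.2] `&` `[J.1, J.2]) !=set0.

Definition sigma_input (sigma : R) s : Prop :=
  forall I, I \in s -> 1 <= I.2 - I.1 /\ I.2 - I.1 <= sigma.

(* Vertices are the positions in s, so that two occurrences of the same
   interval must receive different colors. *)
Definition proper_coloring s (c : nat -> nat) : Prop :=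
  forall i j, (i < size s)%N -> (j < size s)%N -> i <> j ->
    overlap (nth (0, 0) s i) (nth (0, 0) s j) -> c i <> c j.

Definition num_colors (n : nat) (c : nat -> nat) : nat :=
  size (undup (mkseq c n)).

Definition colorable (chi : nat) s : Prop :=
  exists2 c : nat -> nat,
    proper_coloring s c & (num_colors (size s) c <= chi)%N.

(* A deterministic online algorithm maps the nonempty sequence of intervals
   presented so far to the color of the last one.  Its own earlier answers are
   determined by this sequence, hence need not be passed as an argument. *)
Definition online_algorithm : Type := seq (R * R) -> nat.

Implicit Type A : online_algorithm.

Definition online_color A s (i : nat) : nat := A (take i.+1 s).

Definition solves_coloring (sigma : R) A : Prop :=
  forall s, sigma_input sigma s -> proper_coloring s (online_color A s).

(* The maximum A(chi), with value +oo if the number of colors is unbounded. *)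
Definition max_colors (sigma : R) A (chi : nat) : \bar R :=
  ereal_sup [set (num_colors (size s) (online_color A s))%:R%:E
            | s in [set s | sigma_input sigma s /\ colorable chi s]].

Definition competitive (sigma : R) A (alpha : R) : Prop :=
  (limn_esup (fun chi : nat => max_colors sigma A chi / chi%:R%:E)
     <= alpha%:E)%E.

End OnlineIntervalColoring.

(* Main.v *)
Require Import Defs.
From mathcomp Require Import all_boot all_order all_algebra.
From mathcomp Require Import all_classical all_reals all_analysis.
From mathcomp Require Import zify lra.
Import Order.TTheory GRing.Theory Num.Theory.
Local Open Scope ring_scope.
Set Implicit Arguments.
Unset Strict Implicit.
Unset Printing Implicit Defensive.

(** The adversary works with 2n-colorable inputs and forces 7n/2 colors, for
    every n.  Let 0 < d <= 1 be such that 2 + 3d <= sigma.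

    Left part: n copies of M1 = [0, 1], and to their left a clique of unit
    intervals whose right ends lie in ]-d, 0[.  The position of each of these
    depends on the previous answers: a binary search puts the right ends of all
    intervals with a color not used on M1 beyond a threshold p, and all others
    before it ([separate]).  At most n colors occur on M1, so n of these visible
    intervals are obtained while at most n hidden ones are wasted
    ([separated_clique]).  Hence an interval that starts at p and covers M1
    sees a set X of 2n colors, although M1 and the visible intervals lie apart
    and each of the two groups has only n members.  Right part: the mirror
    image, with n copies of M2 = [1 + d, 2 + d], a threshold q between 2 + d
    and 2 + 2d, and a set Z of 2n colors.

    Let k be the number of colors that X and Z share.

    - If 2k <= 3n, then n copies of [p, q] see both X and Z, that is 4n - k
      colors, and need n further ones: 5n - k >= 7n/2 colors in all
      ([colors_few_shared]).
    - If 2k > 3n, then n copies of [1 + d/2, q] come first.  They see Z, so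
      their colors avoid Z; only 2n - k colors of X lie outside Z, so at least
      k - n of their colors lie outside X.  Then n copies of [p, 1 + d/2] see X
      and these intervals, but neither M2 nor the right clique, and need n
      further colors: 2n + (k - n) + n >= 7n/2 colors in all
      ([colors_many_shared]).

    In both cases the intervals split into two halves, each of which is a
    sequence of blocks of at most n intervals lying one to the right of the
    other.  Each half is therefore n-colorable, and the input 2n-colorable. *)

(** * Conflict-free lists of colored intervals *)

(** For nonempty intervals this decides [overlap]. *)
Definition meets (R : realType) (I J : R * R) : bool :=
  (I.1 <= J.2) && (J.1 <= I.2).

Definition compatible (R : realType) : rel ((R * R) * nat) :=
  fun u v => meets u.1 v.1 ==> (u.2 != v.2).

Lemma compatible_sym (R : realType) : symmetric (@compatible R).
Proof. by move=> u v; rewrite /compatible /meets andbC eq_sym. Qed.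

Lemma overlap_meets (R : realType) (I J : R * R) : overlap I J -> meets I J.
Proof.
case=> x [] /=; rewrite !in_itv /= => /andP[I1 I2] /andP[J1 J2].
by rewrite /meets (le_trans I1 J2) (le_trans J1 I2).
Qed.

Lemma meets_overlap (R : realType) (I J : R * R) :
  I.1 <= I.2 -> J.1 <= J.2 -> meets I J -> overlap I J.
Proof.
move=> leI leJ /andP[IJ JI]; exists (Num.max I.1 J.1); split => /=;
  by rewrite in_itv /= le_max ge_max lexx ?orbT /= ?leI ?leJ ?IJ ?JI.
Qed.

(** Swapping the two parts of a concatenation preserves [pairwise r] when [r] is
    symmetric, so rotations do, and every permutation is built from these. *)
Lemma perm_pairwise (T : eqType) (r : rel T) (s t : seq T) :
  symmetric r -> perm_eq s t -> pairwise r s -> pairwise r t.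
Proof.
move=> symr; elim: s t => [|x s IHs] t.
  by rewrite perm_sym => /perm_nilP ->.
rewrite perm_sym => /perm_consP[i [u [rot_t perm_us]]] /= /andP[xs pws].
have : pairwise r (rot i t).
  rewrite rot_t /= (IHs u) ?andbT //; last by rewrite perm_sym.
  by rewrite (perm_all _ perm_us).
rewrite -{2}[t](cat_take_drop i) /rot !pairwise_cat allrelC.
rewrite (eq_allrel (r' := r)); last by move=> a b /=; rewrite symr.
by case/and3P=> -> -> ->.
Qed.

(** This is what forces new colors: intervals that meet everything in a selected
    part [P'] of the earlier input repeat no color of [P']. *)
Lemma compatible_fresh (R : realType) (P P' Q : seq ((R * R) * nat)) :
  pairwise (@compatible R) (P ++ Q) -> {subset P' <= P} ->
  (forall u v, u \in P' -> v \in Q -> meets u.1 v.1) ->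
  ~~ has (mem (unzip2 P')) (unzip2 Q).
Proof.
rewrite pairwise_cat => /and3P[/allrelP PQ _ _] subP meet.
apply/hasPn => _ /mapP[v vQ ->]; apply/negP => /mapP[u uP' eq_uv].
by have := PQ u v (subP _ uP') vQ; rewrite /compatible meet //= eq_uv eqxx.
Qed.

Lemma clique_uniq (R : realType) (P : seq ((R * R) * nat)) :
  pairwise (@compatible R) P ->
  (forall u v, u \in P -> v \in P -> meets u.1 v.1) -> uniq (unzip2 P).
Proof.
move=> pwP meet; rewrite uniq_pairwise pairwise_map.
apply: (@sub_in_pairwise _ (mem P) _ _ _ P) pwP; last by apply/allP.
by move=> u v uP vP /=; rewrite /compatible meet.
Qed.

(** * Offline colorings *)

(** [colorable] with the coloring attached to the intervals instead of to their
    positions.  In this form it is stable under reordering and concatenation,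
    which lets an input be split into blocks regardless of the order of
    presentation. *)
Definition colored (R : realType) (chi : nat) (s : seq (R * R)) : Prop :=
  exists W : seq ((R * R) * nat),
    [/\ unzip1 W = s, pairwise (@compatible R) W & all (fun u => u.2 < chi)%N W].

Lemma colored_colorable (R : realType) (chi : nat) (s : seq (R * R)) :
  colored chi s -> colorable chi s.
Proof.
move=> [W [<- pwW ltW]]; set w0 : (R * R) * nat := ((0, 0), 0%N).
have nth1 i : nth (0, 0) (unzip1 W) i = (nth w0 W i).1.
  case: (ltnP i (size W)) => iW; first by rewrite (nth_map w0).
  by rewrite !nth_default ?size_map.
exists (fun i => (nth w0 W i).2); rewrite ?size_map.
  move=> i j iW jW /eqP neq_ij; rewrite !nth1 => /overlap_meets meet.
  rewrite !size_map in iW jW.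
  have compat k l : (k < l)%N -> (l < size W)%N -> meets (nth w0 W k).1 (nth w0 W l).1 ->
      (nth w0 W k).2 != (nth w0 W l).2.
    move=> lt_kl lW mkl.
    have := pairwiseP w0 pwW k l (ltn_trans lt_kl lW) lW lt_kl.
    by rewrite /compatible mkl.
  apply/eqP; case: (ltngtP i j) neq_ij => // [ij|ji] _; first exact: compat.
  by rewrite eq_sym; apply: compat => //; move: meet; rewrite /meets andbC.
rewrite /num_colors -[leqRHS](size_iota 0); apply: uniq_leq_size (undup_uniq _) _.
move=> c; rewrite mem_undup mem_iota add0n => /mapP[i].
rewrite mem_iota add0n => iW ->.
exact: (allP ltW _ (mem_nth w0 iW)).
Qed.

Lemma colored_perm (R : realType) (chi : nat) (s t : seq (R * R)) :
  perm_eq s t -> colored chi s -> colored chi t.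
Proof.
rewrite perm_sym => /(perm_iotaP (0, 0))[Is permI ->] [W [Ws pwW ltW]].
pose w0 : (R * R) * nat := ((0, 0), 0%N).
rewrite -Ws size_map in permI *.
have permW : perm_eq W [seq nth w0 W i | i <- Is].
  by rewrite perm_sym; apply/(perm_iotaP w0); exists Is.
exists [seq nth w0 W i | i <- Is]; split.
- rewrite /unzip1 -map_comp; apply/eq_in_map => i; rewrite (perm_mem permI).
  by rewrite mem_iota add0n => iW; rewrite /= (nth_map w0).
- exact: perm_pairwise (@compatible_sym R) permW pwW.
- by rewrite -(perm_all _ permW).
Qed.

Lemma colored_size (R : realType) (chi : nat) (s : seq (R * R)) :
  (size s <= chi)%N -> colored chi s.
Proof.
move=> le_s; exists (zip s (iota 0 (size s))).
split; first by rewrite unzip1_zip ?size_iota.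
- have : uniq (unzip2 (zip s (iota 0 (size s)))).
    by rewrite unzip2_zip ?iota_uniq ?size_iota.
  rewrite uniq_pairwise pairwise_map; apply: sub_pairwise => u v /= neq_uv.
  exact/implyP.
- rewrite -(all_map snd (fun c => c < chi)%N) -/(unzip2 _) unzip2_zip ?size_iota //.
  by apply/allP => c; rewrite mem_iota add0n => /leq_trans; apply.
Qed.

Lemma colored_cat (R : realType) (m n : nat) (s t : seq (R * R)) :
  colored m s -> colored n t -> colored (m + n) (s ++ t).
Proof.
move=> [V [<- pwV ltV]] [W [<- pwW ltW]].
pose W' := [seq (u.1, (m + u.2)%N) | u <- W]; exists (V ++ W'); split.
- by rewrite /unzip1 map_cat -map_comp.
- rewrite pairwise_cat pwV pairwise_map; apply/and3P; split=> //.
    apply/allrelP => u _ uV /mapP[w wW ->]; apply/implyP => _ /=.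
    by have /= := allP ltV u uV; lia.
  apply: sub_pairwise pwW => u v; rewrite /compatible /= eqn_add2l; exact.
- rewrite all_cat all_map; apply/andP; split.
    by apply: sub_all ltV => u /=; lia.
  by apply: sub_all ltW => u /=; lia.
Qed.

(** Intervals of [s] and [t] never meet, so the two parts share one palette. *)
Lemma colored_apart (R : realType) (n : nat) (s t : seq (R * R)) :
  colored n s -> colored n t ->
  (forall I J, I \in s -> J \in t -> I.2 < J.1) -> colored n (s ++ t).
Proof.
move=> [V [<- pwV ltV]] [W [<- pwW ltW]] left_of; exists (V ++ W); split.
- by rewrite /unzip1 map_cat.
- rewrite pairwise_cat pwV pwW !andbT; apply/allrelP => u v uV vW.
  have := left_of _ _ (map_f _ uV) (map_f _ vW).
  by rewrite /compatible /meets ltNge => /negPf ->; rewrite andbF.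
- by rewrite all_cat ltV.
Qed.

(** * Transcripts of an online algorithm *)

Fixpoint run (R : realType) (A : online_algorithm R) (h t : seq (R * R)) :
    seq ((R * R) * nat) :=
  if t is J :: t' then (J, A (rcons h J)) :: run A (rcons h J) t' else [::].

Lemma unzip1_run (R : realType) (A : online_algorithm R) h t :
  unzip1 (run A h t) = t.
Proof. by elim: t h => //= I t IHt h; rewrite IHt. Qed.

Lemma size_run (R : realType) (A : online_algorithm R) h t :
  size (run A h t) = size t.
Proof. by rewrite -{2}[t](unzip1_run A h) size_map. Qed.

(** An adaptive input is played piece by piece; each piece is then analysed
    through its own part of the transcript. *)
Lemma run_cat (R : realType) (A : online_algorithm R) h t1 t2 :
  run A h (t1 ++ t2) = run A h t1 ++ run A (h ++ t1) t2.
Proof. by elim: t1 h => [|I t1 IH] h /=; rewrite ?cats0 // IH cat_rcons. Qed.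

Lemma take_run (R : realType) (A : online_algorithm R) h t N :
  run A h (take N t) = take N (run A h t).
Proof. by elim: t h N => [|I t IH] h [|N] //=; rewrite IH. Qed.

Lemma unzip2_run (R : realType) (A : online_algorithm R) h t :
  unzip2 (run A h t) = mkseq (fun i => A (h ++ take i.+1 t)) (size t).
Proof.
elim: t h => //= I t IHt h; rewrite IHt /mkseq /= take0 cats1 (iotaDl 1 0) -map_comp.
by congr cons; apply: eq_map => i /=; rewrite cat_rcons.
Qed.

Lemma mem_run_nseq (R : realType) (A : online_algorithm R) h n I u :
  u \in run A h (nseq n I) -> u.1 = I.
Proof.
by move/(map_f fst); rewrite -/(unzip1 _) unzip1_run => /nseqP[].
Qed.

Lemma num_colors_run (R : realType) (A : online_algorithm R) (s : seq (R * R)) :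
  num_colors (size s) (online_color A s) = size (undup (unzip2 (run A [::] s))).
Proof. by rewrite unzip2_run. Qed.

Lemma run_compatible (R : realType) (sigma : R) (A : online_algorithm R) s :
  solves_coloring sigma A -> sigma_input sigma s ->
  pairwise (@compatible R) (run A [::] s).
Proof.
move=> solA inp; pose w0 : (R * R) * nat := ((0, 0), 0%N).
have [sz1 sz2] := (size_run A [::] s, unzip2_run A [::] s).
apply/(pairwiseP w0) => i j; rewrite !inE sz1 => iS jS lt_ij.
have E k : (k < size s)%N ->
    (nth w0 (run A [::] s) k = (nth (0, 0) s k, online_color A s k)).
  move=> kS; rewrite [LHS]surjective_pairing; congr pair.
    by rewrite -(nth_map w0 (0, 0) fst) ?sz1 // -/(unzip1 _) unzip1_run.
  rewrite -(nth_map w0 0%N snd) ?sz1 // -/(unzip2 _) sz2 nth_mkseq //.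
rewrite (E i iS) (E j jS) /compatible /=; apply/implyP => meet; apply/eqP.
have len k : (k < size s)%N -> (nth (0, 0) s k).1 <= (nth (0, 0) s k).2.
  by move=> kS; have [] := inp _ (mem_nth (0, 0) kS); lra.
apply: (solA s inp i j iS jS); first by move=> eq_ij; rewrite eq_ij ltnn in lt_ij.
by apply: meets_overlap; rewrite ?len.
Qed.

Lemma sigma_input_cat (R : realType) (sigma : R) (s t : seq (R * R)) :
  sigma_input sigma s -> sigma_input sigma t -> sigma_input sigma (s ++ t).
Proof. by move=> hs ht I; rewrite mem_cat => /orP[/hs|/ht]. Qed.

Lemma sigma_input_nseq (R : realType) (sigma : R) n (I : R * R) :
  1 <= I.2 - I.1 -> I.2 - I.1 <= sigma -> sigma_input sigma (nseq n I).
Proof. by move=> ? ? J /nseqP[-> _]. Qed.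

(** * Separation *)

(** Binary search on the parameter [x]: after a good color the search continues
    below [x], after a bad one above [x].  So every later parameter, and
    finally [p], lies on the correct side of [x]. *)
Lemma separate (R : realType) (A : online_algorithm R) (good : pred nat)
    (mk : R -> R * R) (N : nat) (h : seq (R * R)) (lo hi : R) :
  lo < hi ->
  exists (t : seq (R * R)) (p : R), [/\ size t = N, lo < p < hi &
    forall u, u \in run A h t -> exists x,
      [/\ u.1 = mk x, lo < x < hi & if good u.2 then p < x else x < p]].
Proof.
elim: N h lo hi => [|N IHN] h lo hi lt_lohi.
  exists [::], ((lo + hi) / 2); split=> //; lra.
pose x := (lo + hi) / 2; pose h' := rcons h (mk x).
have [lox xhi] : lo < x /\ x < hi by rewrite /x; lra.
case Eg: (good (A h')).
  have [t [p [szt /andP[lop ph] Ht]]] := IHN h' _ _ lox.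
  exists (mk x :: t), p; split; [by rewrite /= szt | by lra | move=> u /=].
  rewrite inE => /orP[/eqP -> | /Ht[y [-> /andP[loy yx] gy]]].
    by exists x; rewrite Eg; split=> //; rewrite lox.
  by exists y; split=> //; rewrite loy (lt_trans yx).
have [t [p [szt /andP[xp ph] Ht]]] := IHN h' _ _ xhi.
exists (mk x :: t), p; split; [by rewrite /= szt | by lra | move=> u /=].
rewrite inE => /orP[/eqP -> | /Ht[y [-> /andP[xy yhi] gy]]].
  by exists x; rewrite Eg; split=> //; rewrite lox.
by exists y; split=> //; rewrite yhi (lt_trans lox).
Qed.

(** The count grows by at most one per element, so it passes through [k]. *)
Lemma exists_take_count (T : Type) (a : pred T) (s : seq T) k :
  (k <= count a s)%N -> exists N, count a (take N s) = k.
Proof.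
elim: s k => [|x s IHs] [|k] //=; try by exists 0%N.
case: (boolP (a x)) => ax.
  by rewrite add1n ltnS => /IHs[N <-]; exists N.+1; rewrite /= ax add1n.
by rewrite add0n => /IHs[N <-]; exists N.+1; rewrite /= (negPf ax).
Qed.

(** The intervals [mk x] pairwise meet, so their colors are distinct and at most
    [n] of them lie in [Y].  Thus [2n] intervals contain [n] with a color
    outside [Y], and the clique is cut as soon as it has exactly [n] of these. *)
Lemma separated_clique (R : realType) (sigma : R) (A : online_algorithm R)
    (mk : R -> R * R) (Y : seq nat) (n : nat) (h : seq (R * R)) (lo hi : R) :
  solves_coloring sigma A -> sigma_input sigma h -> (size Y <= n)%N -> lo < hi ->
  (forall x, 1 <= (mk x).2 - (mk x).1 <= sigma) ->
  (forall x y, lo < x < hi -> lo < y < hi -> meets (mk x) (mk y)) ->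
  exists (t : seq (R * R)) (p : R),
   [/\ sigma_input sigma t, lo < p < hi,
       forall u, u \in run A h t -> exists x,
         [/\ u.1 = mk x, lo < x < hi & if u.2 \notin Y then p < x else x < p],
       size [seq u <- run A h t | u.2 \notin Y] = n
     & (size [seq u <- run A h t | u.2 \in Y] <= n)%N].
Proof.
move=> solA inph szY lt_lohi len meet.
have [t [p [szt ltp Ht]]] := separate A (fun c => c \notin Y) mk (n + n) h lt_lohi.
have inpt t' : {subset t' <= t} -> sigma_input sigma t'.
  move=> sub I /sub; rewrite -{1}[t](unzip1_run A h) => /mapP[u /Ht[x [-> _ _]] ->].
  exact/andP.
have badY : (count (fun u => u.2 \in Y) (run A h t) <= n)%N.
  apply: leq_trans szY; rewrite -(count_map snd (mem Y)) -size_filter.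
  apply: uniq_leq_size; last by move=> c; rewrite mem_filter => /andP[].
  apply: filter_uniq; apply: clique_uniq => [|u v /Ht[x [-> ltx _]] /Ht[y [-> lty _]]].
    have := run_compatible solA (sigma_input_cat inph (inpt t _)).
    by rewrite run_cat pairwise_cat => /(_ (fun _ => id)) /and3P[].
  exact: meet.
have [|N HN] := @exists_take_count _ (fun u => u.2 \notin Y) (run A h t) n.
  have : (count (fun u => u.2 \in Y) (run A h t) +
          count (fun u => u.2 \notin Y) (run A h t))%N = (n + n)%N.
    by rewrite -szt -(size_run A h); apply: count_predC.
  by move: badY; lia.
have sub : {subset run A h (take N t) <= run A h t}.
  by rewrite take_run; apply/mem_subseq/take_subseq.
exists (take N t), p; split=> //.
- by apply: inpt; apply/mem_subseq/take_subseq.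
- by move=> u /sub/Ht.
- by rewrite size_filter take_run.
- rewrite size_filter; apply: leq_trans badY; rewrite take_run.
  by apply: leq_count_subseq; apply: take_subseq.
Qed.

(** * Counting colors *)

(** In the application [X] and [Z] are the colors on the two parts, [c] those of
    the intervals that see both parts, and [D] all answers. *)
Lemma colors_few_shared (n : nat) (X Z c D : seq nat) :
  uniq X -> uniq Z -> uniq c -> size X = (n + n)%N -> size Z = (n + n)%N ->
  size c = n -> ~~ has (mem X) c -> ~~ has (mem Z) c ->
  {subset X <= D} -> {subset Z <= D} -> {subset c <= D} ->
  (2 * count (mem Z) X <= 3 * n)%N -> (7 * n <= 2 * size (undup D))%N.
Proof.
move=> uX uZ uc szX szZ szc Xc Zc XD ZD cD few.
have u : uniq (Z ++ [seq x <- X | x \notin Z] ++ c).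
  rewrite !cat_uniq uZ uc filter_uniq //= andbT has_cat negb_or Zc andbT.
  apply/andP; split; first by apply/hasPn => x; rewrite mem_filter => /andP[].
  apply/hasPn => x /(hasPn Xc) /=; rewrite mem_filter; apply: contra => /andP[_]; exact.
have /(uniq_leq_size u) : {subset Z ++ [seq x <- X | x \notin Z] ++ c <= undup D}.
  move=> x; rewrite mem_undup !mem_cat mem_filter.
  by case/or3P=> [/ZD|/andP[_ /XD]|/cD].
rewrite !size_cat size_filter szZ szc.
have : (count (mem Z) X + count (fun x => x \notin Z) X)%N = size X.
  exact: count_predC.
by move: few; rewrite szX; lia.
Qed.

(** The colors [b] avoid [Z], so those of them in [X] are among the few colors of
    [X] outside [Z]; the others are new with respect to [X]. *)
Lemma colors_many_shared (n : nat) (X Z b c D : seq nat) :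
  uniq X -> uniq b -> uniq c -> size X = (n + n)%N ->
  size b = n -> size c = n -> ~~ has (mem Z) b -> ~~ has (mem X) c ->
  ~~ has (mem b) c -> {subset X <= D} -> {subset b <= D} -> {subset c <= D} ->
  (3 * n < 2 * count (mem Z) X)%N -> (7 * n <= 2 * size (undup D))%N.
Proof.
move=> uX ub uc szX szb szc Zb Xc bc XD bD cD many.
have u : uniq (X ++ [seq x <- b | x \notin X] ++ c).
  rewrite !cat_uniq uX uc filter_uniq //= andbT has_cat negb_or Xc andbT.
  apply/andP; split; first by apply/hasPn => x; rewrite mem_filter => /andP[].
  apply/hasPn => x /(hasPn bc) /=; rewrite mem_filter; apply: contra => /andP[_]; exact.
have /(uniq_leq_size u) : {subset X ++ [seq x <- b | x \notin X] ++ c <= undup D}.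
  move=> x; rewrite mem_undup !mem_cat mem_filter.
  by case/or3P=> [/XD|/andP[_ /bD]|/cD].
have : (count (mem X) b <= count (predC (mem Z)) X)%N.
  rewrite -!size_filter; apply: uniq_leq_size; first exact: filter_uniq.
  by move=> x; rewrite !mem_filter /= => /andP[-> /(hasPn Zb)] /= ->.
rewrite !size_cat size_filter szX szc.
have : (count (mem X) b + count (fun x => x \notin X) b)%N = size b.
  exact: count_predC.
by have := count_predC (mem Z) X; move: many; rewrite szX szb; lia.
Qed.

(** * The adversary *)

(** The colors of a clique [P] and the colors outside them on a second clique [Q]
    are all distinct even if the two cliques lie apart: this gives the sets X
    and Z their [2n] elements. *)
Lemma visible_uniq (R : realType) (P Q : seq ((R * R) * nat)) :
  pairwise (@compatible R) (P ++ Q) ->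
  (forall u v, u \in P -> v \in P -> meets u.1 v.1) ->
  (forall u v, u \in Q -> v \in Q -> meets u.1 v.1) ->
  uniq (unzip2 (P ++ [seq u <- Q | u.2 \notin unzip2 P])).
Proof.
rewrite pairwise_cat => /and3P[_ pwP pwQ] meetP meetQ.
rewrite /unzip2 map_cat cat_uniq (clique_uniq pwP meetP) /=; apply/andP; split.
  by apply/hasPn => _ /mapP[u + ->]; rewrite mem_filter => /andP[].
apply: clique_uniq => [|u v]; first exact: pairwise_filter.
by rewrite !mem_filter => /andP[_ uQ] /andP[_ vQ]; apply: meetQ.
Qed.

(** The left-hand sides of the next two lemmas are the two halves of the finished
    input, each from left to right; the right-hand sides are in the order of
    presentation.  The visible and hidden members [va], [ha] of a clique always
    end up in different halves, because bridges meet the visible ones only. *)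
Lemma perm_one_bridge (T : eqType) (m1 a va ha m2 b vb hb c : seq T) :
  perm_eq a (va ++ ha) -> perm_eq b (vb ++ hb) ->
  perm_eq ((va ++ m1 ++ m2 ++ vb) ++ (ha ++ c ++ hb))
          ((((m1 ++ a) ++ m2) ++ b) ++ c).
Proof.
move=> /permP pa /permP pb; apply/permP => f; rewrite !count_cat pa pb.
by rewrite !count_cat; lia.
Qed.

Lemma perm_two_bridges (T : eqType) (m1 a va ha m2 b vb hb c c' : seq T) :
  perm_eq a (va ++ ha) -> perm_eq b (vb ++ hb) ->
  perm_eq ((va ++ m1 ++ c ++ hb) ++ (ha ++ c' ++ m2 ++ vb))
          (((((m1 ++ a) ++ m2) ++ b) ++ c) ++ c').
Proof.
move=> /permP pa /permP pb; apply/permP => f; rewrite !count_cat pa pb.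
by rewrite !count_cat; lia.
Qed.

(** The input is presented in the order M1, left clique, M2, right clique,
    bridging intervals; the bridging intervals depend on how many colors the two
    parts share. *)
Lemma adversary (R : realType) (sigma : R) (A : online_algorithm R) (n : nat) :
  2 < sigma -> solves_coloring sigma A ->
  exists s, [/\ sigma_input sigma s, colorable (n + n) s
    & (7 * n <= 2 * num_colors (size s) (online_color A s))%N].
Proof.
move=> lt2s solA.
have [d [d_gt0 d_le1 d_le]] : exists d : R, [/\ 0 < d, d <= 1 & 2 + 3 * d <= sigma].
  (* d <= 1 makes any two members of the left clique meet. *)
  case: (lerP sigma 5) => ?; last by exists 1; split; lra.
  by exists ((sigma - 2) / 3); split; lra.
pose m1 := nseq n (0 : R, 1 : R); pose W1 := run A [::] m1.
have inp1 : sigma_input sigma m1 by apply: sigma_input_nseq => /=; lra.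
have E1 u : u \in W1 -> u.1 = (0, 1) by apply: mem_run_nseq.
have szY1 : (size (unzip2 W1) <= n)%N by rewrite size_map size_run size_nseq.
pose mkA x : R * R := (x - 1, x).
have [||x y|a [p [inpa ltp EA visA hidA]]] := separated_clique (mk := mkA)
  (lo := - d) (hi := 0) solA inp1 szY1.
- by lra.
- by move=> x /=; lra.
- by rewrite /meets /=; lra.
set WA := run A m1 a in EA visA hidA.
pose h2 := m1 ++ a; pose m2 := nseq n (1 + d, 2 + d); pose W2 := run A h2 m2.
have inp2 : sigma_input sigma m2 by apply: sigma_input_nseq => /=; lra.
have E2 u : u \in W2 -> u.1 = (1 + d, 2 + d) by apply: mem_run_nseq.
have szY2 : (size (unzip2 W2) <= n)%N by rewrite size_map size_run size_nseq.
(* The parameter is minus the left end, so that on this side too the visible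
   intervals are those with a large parameter. *)
pose h3 := h2 ++ m2; pose mkB x : R * R := (- x, 1 - x).
have inp3 : sigma_input sigma h3 by do ?apply: sigma_input_cat.
have [||x y|b [q' [inpb ltq EB visB hidB]]] := separated_clique (mk := mkB)
  (lo := - (2 + 2 * d)) (hi := - (2 + d)) solA inp3 szY2.
- by lra.
- by move=> x /=; lra.
- by rewrite /meets /=; lra.
set WB := run A h3 b in EB visB hidB; pose q := - q'.
have qE : q = - q' by [].
have {}ltq : 2 + d < q < 2 + 2 * d by lra.
pose vA := [seq u <- WA | u.2 \notin unzip2 W1].
pose hA := [seq u <- WA | u.2 \in unzip2 W1].
pose vB := [seq u <- WB | u.2 \notin unzip2 W2].
pose hB := [seq u <- WB | u.2 \in unzip2 W2].
have EvA u : u \in vA -> p < u.1.2 < 0.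
  by rewrite mem_filter => /andP[Yu /EA[x [-> ltx]]]; rewrite Yu /=; lra.
have EhA u : u \in hA -> u.1.2 < p.
  by rewrite mem_filter => /andP[Yu /EA[x [-> ltx]]]; rewrite Yu /=; lra.
have EvA1 u : u \in vA -> u.1.1 < p.
  by rewrite mem_filter => /andP[Yu /EA[x [-> ltx]]]; rewrite Yu /=; lra.
have EvB u : u \in vB -> 2 + d < u.1.1 < q.
  by rewrite mem_filter => /andP[Yu /EB[x [-> ltx]]]; rewrite Yu /=; lra.
have EhB u : u \in hB -> q < u.1.1.
  by rewrite mem_filter => /andP[Yu /EB[x [-> ltx]]]; rewrite Yu /=; lra.
have EvB2 u : u \in vB -> q < u.1.2.
  by rewrite mem_filter => /andP[Yu /EB[x [-> ltx]]]; rewrite Yu /=; lra.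
pose s1 := h3 ++ b; pose W := run A [::] s1.
have inps1 : sigma_input sigma s1 by apply: sigma_input_cat.
have EW : W = ((W1 ++ WA) ++ W2) ++ WB by rewrite /W /s1 /h3 /h2 !run_cat.
have pwW : pairwise (@compatible R) W by apply: run_compatible inps1.
pose X := unzip2 (W1 ++ vA); pose Z := unzip2 (W2 ++ vB).
have subX : {subset W1 ++ vA <= W}.
  by move=> u; rewrite EW !mem_cat mem_filter => /orP[->|/andP[_ ->]]; rewrite ?orbT.
have subZ : {subset W2 ++ vB <= W}.
  by move=> u; rewrite EW !mem_cat mem_filter => /orP[->|/andP[_ ->]]; rewrite ?orbT.
have uX : uniq X.
  apply: visible_uniq => [|u v /E1-> /E1->|u v /EA[x [-> ? _]] /EA[y [-> ? _]]].
  - by move: pwW; rewrite EW !pairwise_cat; case/and3P => _ /and3P[].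
  - by rewrite /meets /=; lra.
  - by rewrite /meets /=; lra.
have uZ : uniq Z.
  apply: visible_uniq => [|u v /E2-> /E2->|u v /EB[x [-> ? _]] /EB[y [-> ? _]]].
  - by move: pwW; rewrite EW -catA pairwise_cat; case/and3P.
  - by rewrite /meets /=; lra.
  - by rewrite /meets /=; lra.
have szX : size X = (n + n)%N by rewrite size_map size_cat visA size_run size_nseq.
have szZ : size Z = (n + n)%N by rewrite size_map size_cat visB size_run size_nseq.
have perm_a : perm_eq a (unzip1 vA ++ unzip1 hA).
  rewrite -{1}[a](unzip1_run A m1) -map_cat; apply: perm_map.
  by rewrite perm_sym perm_catC; apply/permPl/perm_filterC.
have perm_b : perm_eq b (unzip1 vB ++ unzip1 hB).
  rewrite -{1}[b](unzip1_run A h3) -map_cat; apply: perm_map.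
  by rewrite perm_sym perm_catC; apply/permPl/perm_filterC.
have colC I : colored n (nseq n I) by apply: colored_size; rewrite size_nseq.
have [colm1 colm2] : colored n m1 /\ colored n m2 by split; apply: colC.
have [cvA chA cvB chB] : [/\ colored n (unzip1 vA), colored n (unzip1 hA),
    colored n (unzip1 vB) & colored n (unzip1 hB)].
  by split; apply: colored_size; rewrite size_map ?visA ?visB.
have IvA I : I \in unzip1 vA -> p < I.2 < 0 by move=> /mapP[u /EvA ? ->].
have IhA I : I \in unzip1 hA -> I.2 < p by move=> /mapP[u /EhA ? ->].
have IvB I : I \in unzip1 vB -> 2 + d < I.1 < q by move=> /mapP[u /EvB ? ->].
have IhB I : I \in unzip1 hB -> q < I.1 by move=> /mapP[u /EhB ? ->].
(* Offline, M1 and M2 share a palette with the visible intervals if the bridges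
   cover both; if two kinds of bridges meet between M1 and M2, the right part
   swaps its palettes. *)
case: (leqP (2 * count (mem Z) X) (3 * n)) => shared.
- pose C : R * R := (p, q); pose s := s1 ++ nseq n C.
  have inps : sigma_input sigma s.
    by apply: sigma_input_cat => //; apply: sigma_input_nseq => /=; lra.
  have ER : run A [::] s = W ++ run A s1 (nseq n C) by rewrite run_cat.
  have pwR : pairwise (@compatible R) (W ++ run A s1 (nseq n C)).
    by rewrite -ER; apply: run_compatible inps.
  exists s; split=> //.
    apply: colored_colorable.
    pose s' := (unzip1 vA ++ m1 ++ m2 ++ unzip1 vB)
               ++ (unzip1 hA ++ nseq n C ++ unzip1 hB).
    apply: (@colored_perm _ _ s').
      exact: perm_one_bridge perm_a perm_b.
    apply: colored_cat.
      do 3?[apply: colored_apart => //] => I J; rewrite ?mem_cat.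
      - by move=> /nseqP[-> _] /IvB /=; lra.
      - by move=> /nseqP[-> _] /orP[/nseqP[-> _]|/IvB] /=; lra.
      - by move=> /IvA + /or3P[/nseqP[-> _]|/nseqP[-> _]|/IvB] /=; lra.
    do 2?[apply: colored_apart => //] => I J; rewrite ?mem_cat.
    - by move=> /nseqP[-> _] /IhB /=; lra.
    - by move=> /IhA + /orP[/nseqP[-> _]|/IhB] /=; lra.
  rewrite num_colors_run ER.
  set WC := run A s1 (nseq n C); set D := unzip2 _.
  have EC u : u \in WC -> u.1 = C by apply: mem_run_nseq.
  have XD : {subset X <= D}.
    by move=> c /mapP[u /subX uW ->]; apply: map_f; rewrite mem_cat uW.
  have ZD : {subset Z <= D}.
    by move=> c /mapP[u /subZ uW ->]; apply: map_f; rewrite mem_cat uW.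
  have CD : {subset unzip2 WC <= D}.
    by move=> c /mapP[u uW ->]; apply: map_f; rewrite mem_cat uW orbT.
  have uC : uniq (unzip2 WC).
    apply: clique_uniq => [|u v /EC-> /EC->]; last by rewrite /meets /=; lra.
    by move: pwR; rewrite pairwise_cat; case/and3P.
  have szC : size (unzip2 WC) = n by rewrite size_map size_run size_nseq.
  have XC : ~~ has (mem X) (unzip2 WC).
    apply: compatible_fresh pwR subX _ => u v; rewrite mem_cat.
    by case/orP=> [/E1->|uvA] /EC->; rewrite /meets /=;
      [lra|have := EvA _ uvA; have := EvA1 _ uvA; lra].
  have ZC : ~~ has (mem Z) (unzip2 WC).
    apply: compatible_fresh pwR subZ _ => u v; rewrite mem_cat.
    by case/orP=> [/E2->|uvB] /EC->; rewrite /meets /=;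
      [lra|have := EvB _ uvB; have := EvB2 _ uvB; lra].
  exact: colors_few_shared uX uZ uC szX szZ szC XC ZC XD ZD CD shared.
- pose B : R * R := (1 + d / 2, q); pose C : R * R := (p, 1 + d / 2).
  pose s2 := s1 ++ nseq n B; pose s := s2 ++ nseq n C.
  have inps : sigma_input sigma s.
    by do 2?[apply: sigma_input_cat => //]; apply: sigma_input_nseq => /=; lra.
  set WB' := run A s1 (nseq n B); set WC := run A s2 (nseq n C).
  have ER : run A [::] s = (W ++ WB') ++ WC by rewrite run_cat run_cat.
  have pwR : pairwise (@compatible R) ((W ++ WB') ++ WC).
    by rewrite -ER; apply: run_compatible inps.
  have pwWB : pairwise (@compatible R) (W ++ WB').
    by move: pwR; rewrite pairwise_cat; case/and3P.
  exists s; split=> //.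
    apply: colored_colorable.
    pose s' := (unzip1 vA ++ m1 ++ nseq n B ++ unzip1 hB)
               ++ (unzip1 hA ++ nseq n C ++ m2 ++ unzip1 vB).
    apply: (@colored_perm _ _ s').
      exact: perm_two_bridges perm_a perm_b.
    apply: colored_cat.
      do 3?[apply: colored_apart => //] => I J; rewrite ?mem_cat.
      - by move=> /nseqP[-> _] /IhB /=; lra.
      - by move=> /nseqP[-> _] /orP[/nseqP[-> _]|/IhB] /=; lra.
      - by move=> /IvA + /or3P[/nseqP[-> _]|/nseqP[-> _]|/IhB] /=; lra.
    do 3?[apply: colored_apart => //] => I J; rewrite ?mem_cat.
    - by move=> /nseqP[-> _] /IvB /=; lra.
    - by move=> /nseqP[-> _] /orP[/nseqP[-> _]|/IvB] /=; lra.
    - by move=> /IhA + /or3P[/nseqP[-> _]|/nseqP[-> _]|/IvB] /=; lra.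
  rewrite num_colors_run ER; set D := unzip2 _.
  have EB' u : u \in WB' -> u.1 = B by apply: mem_run_nseq.
  have EC u : u \in WC -> u.1 = C by apply: mem_run_nseq.
  have XD : {subset X <= D}.
    by move=> c /mapP[u /subX uW ->]; apply: map_f; rewrite !mem_cat uW.
  have BD : {subset unzip2 WB' <= D}.
    by move=> c /mapP[u uW ->]; apply: map_f; rewrite !mem_cat uW orbT.
  have CD : {subset unzip2 WC <= D}.
    by move=> c /mapP[u uW ->]; apply: map_f; rewrite mem_cat uW orbT.
  have uB : uniq (unzip2 WB').
    apply: clique_uniq => [|u v /EB'-> /EB'->]; last by rewrite /meets /=; lra.
    by move: pwWB; rewrite pairwise_cat; case/and3P.
  have uC : uniq (unzip2 WC).
    apply: clique_uniq => [|u v /EC-> /EC->]; last by rewrite /meets /=; lra.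
    by move: pwR; rewrite pairwise_cat; case/and3P.
  have szB : size (unzip2 WB') = n by rewrite size_map size_run size_nseq.
  have szC : size (unzip2 WC) = n by rewrite size_map size_run size_nseq.
  have ZB : ~~ has (mem Z) (unzip2 WB').
    apply: compatible_fresh pwWB subZ _ => u v; rewrite mem_cat.
    by case/orP=> [/E2->|uvB] /EB'->; rewrite /meets /=;
      [lra|have := EvB _ uvB; have := EvB2 _ uvB; lra].
  have XC : ~~ has (mem X) (unzip2 WC).
    apply: compatible_fresh pwR _ _ => [u /subX uW|u v]; rewrite mem_cat ?uW //.
    by case/orP=> [/E1->|uvA] /EC->; rewrite /meets /=;
      [lra|have := EvA _ uvA; have := EvA1 _ uvA; lra].
  have BC : ~~ has (mem (unzip2 WB')) (unzip2 WC).
    apply: compatible_fresh pwR _ _ => [u uW|u v /EB'-> /EC->].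
      by rewrite mem_cat uW orbT.
    by rewrite /meets /=; lra.
  exact: colors_many_shared uX uB uC szX szB szC ZB XC BC XD BD CD shared.
Qed.

(** * From inputs to the asymptotic ratio *)

Lemma limn_esup_ge (R : realType) (u : nat -> \bar R) (c : \bar R) :
  (forall N, exists2 k, (N <= k)%N & (c <= u k)%E) -> (c <= limn_esup u)%E.
Proof.
move=> freq; rewrite limn_esup_lim; apply: lime_ge; first exact: is_cvg_esups.
apply: nearW => N; have [k Nk cu] := freq N.
by apply: le_trans cu _; apply: ereal_sup_ubound; exists k.
Qed.

Unset Implicit Arguments.

(** The adversary is applied to the even values 2n of chi, which suffices for a
    lower bound on the upper limit. *)
Theorem theorem5 (R : realType) (sigma : R) (hsigma : 2 < sigma) :
  ~ exists (A : online_algorithm R) (alpha : R),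
      [/\ solves_coloring sigma A, alpha < 7 / 4 & competitive sigma A alpha].
Proof.
move=> [A [alpha [solA lt_alpha]]]; rewrite /competitive.
apply/negP; rewrite -ltNge; apply: (@lt_le_trans _ _ (7 / 4 : R)%:E).
  by rewrite lte_fin.
apply: limn_esup_ge => N; exists (N.+1 + N.+1)%N; first by lia.
have [s [inps cols many]] := adversary N.+1 hsigma solA.
set k := num_colors _ _ in many.
have k_le : (k%:R%:E <= max_colors sigma A (N.+1 + N.+1))%E.
  by apply: ereal_sup_ubound; exists s.
have chi_gt0 : 0 < (N.+1 + N.+1)%:R :> R by rewrite ltr0n.
rewrite inver gt_eqF //; apply: le_trans (lee_wpmul2r _ k_le).
  rewrite -EFinM lee_fin ler_pdivlMr //.
  have : ((7 * N.+1)%:R <= (2 * k)%:R :> R) by rewrite ler_nat.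
  by rewrite !natrM natrD; lra.
by rewrite lee_fin invr_ge0 ltW.
Qed.
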